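(* Let $\mathcal Y$ be a finite set, and let the local randomizers $W^{(n)}$ be in the sparse-error critical regime with dominant outputs $(y_0,y_1)$ and intensities $\alpha_b(y)$ $(b\in\{0,1\},\ y\neq y_b)$, with $nW_b^{(n)}(y)=\alpha_b(y)+O(1/n)$ uniformly in $y$ and $b$ ($y\ne y_b$). Let $k=k(n)\in\{0,\dots,n-1\}$ with $\pi_n:=k/n$ satisfying $|\pi_n-\pi|=O(1/n)$ for some $\pi\in[0,1]$. Let $P_n$ be the law of $H_{n,k}$ under $T_{n,k}$, $Q_n$ the law of $H_{n,k}$ under $T_{n,k+1}$ (same centering using $k$), $P_\infty:=\mathcal L(H_\infty)$ and $Q_\infty:=\mathcal L(H_\infty+e_{y_1}-e_{y_0})$. Then there exists a constant $C>0$ depending only on the $\alpha_b(y)$ and $\pi$ such that $$\Delta\bigl((P_n,Q_n),(P_\infty,Q_\infty)\bigr)\le\frac Cn.$$ Moreover, for every fixed $\varepsilon\ge0$, $$\bigl|\delta_{Q_n\|P_n}(\varepsilon)-\delta_{Q_\infty\|P_\infty}(\varepsilon)\bigr|\le\frac{C(1+e^{\varepsilon})}{n}.$$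
   Context: For each $n$, $W^{(n)}$ consists of two probability vectors $W_0^{(n)},W_1^{(n)}$ on $\mathcal Y$. Under $T_{n,k}$ there are $n-k$ users with input $0$ and $k$ users with input $1$; each user with input $b$ independently outputs a message from $W_b^{(n)}$, and $N=(N(y))_{y\in\mathcal Y}$, where $N(y)$ is the number of messages equal to $y$, is the released histogram. Sparse-error critical regime with dominant outputs $(y_0,y_1)$: $y_0\ne y_1$, and there are nonnegative $\{\alpha_0(y)\}_{y\neq y_0}$, $\{\alpha_1(y)\}_{y\neq y_1}$ such that $nW_b^{(n)}(y)\to\alpha_b(y)$ for $y\ne y_b$ and $W_b^{(n)}(y_b)\to1$, $b\in\{0,1\}$. With $e_y$ the standard basis of $\mathbb Z^{\mathcal Y}$: $H_{n,k}:=N-(n-k)e_{y_0}-ke_{y_1}$, with $N$ the released histogram under the dataset considered; $H_\infty:=\sum_{y\ne y_0}U_y(e_y-e_{y_0})+\sum_{y\neq y_1}V_y(e_y-e_{y_1})$, where all $U_y\sim\mathrm{Poi}((1-\pi)\alpha_0(y))$ and $V_y\sim\mathrm{Poi}(\pi\alpha_1(y))$ are independent. $\mathrm{TV}(\mu,\nu):=\sup_A|\mu(A)-\nu(A)|$. For binary experiments $(P,Q)$, $(P',Q')$, the deficiency of the first relative to the second is $\inf_K\max\{\mathrm{TV}(PK,P'),\mathrm{TV}(QK,Q')\}$ over Markov kernels $K$; the Le Cam distance $\Delta$ is the maximum of the two deficiencies. The privacy curve is $\delta_{Q\|P}(\varepsilon):=\sup_A\{Q(A)-e^{\varepsilon}P(A)\}$,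 over measurable sets $A$.
   Formalization: The constant C may depend, besides the intensities and π, on a common implied constant M of the two O(1/n) hypotheses (assumed as bounds M/n for all n ≥ 1); with C depending only on the intensities and π the claim is false. *)

(* Defs.v *)
From HB Require Import structures.
From mathcomp Require Import all_boot all_order all_algebra.
From mathcomp Require Import all_classical all_reals all_analysis.

Set Implicit Arguments.
Unset Strict Implicit.
Unset Printing Implicit Defensive.

Import Order.TTheory GRing.Theory Num.Theory.
Import numFieldNormedType.Exports.

Local Open Scope classical_set_scope.
Local Open Scope ring_scope.

(* On a finite type the esum is the finite sum, so this is a probability
   vector; on a countable type it is a probability mass function. *)
Record pvector (R : realType) (T : choiceType) := PVector {
  pvector_fun :> T -> R;
  pvector_ge0 : forall t, 0 <= pvector_fun t;
  pvector_sum1 : \esum_(t in [set: T]) (pvector_fun t)%:E = 1%E }.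

Section law.
Context (R : realType) (I : choiceType) d (T : measurableType d).
Local Open Scope ereal_scope.

(* The law of X(i) when the outcome i is drawn from p. *)
Definition law (p : pvector R I) (X : I -> T) (A : set T) : \bar R :=
  \esum_(i in X @^-1` A) (p i)%:E.

Variables (p : pvector R I) (X : I -> T).

Let law0 : law p X set0 = 0.
Proof. by rewrite /law preimage_set0 esum_set0. Qed.

Let law_ge0 A : 0 <= law p X A.
Proof. by apply: esum_ge0 => i _; rewrite lee_fin pvector_ge0. Qed.

Let law_sigma_additive : semi_sigma_additive (law p X).
Proof.
move=> F mF tF mUF; rewrite /law; apply: cvg_toP.
  apply: ereal_nondecreasing_is_cvgn => a b ab.
  by apply: lee_sum_nneg_natr => // n _ _; exact: law_ge0.
rewrite preimage_bigcup nneseries_sum_bigcup//.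
  apply/trivIsetP => i j _ _ ij; rewrite -preimage_setI.
  by move/trivIsetP : tF => ->//; rewrite preimage_set0.
by move=> i; rewrite lee_fin pvector_ge0.
Qed.

HB.instance Definition _ := isMeasure.Build _ _ _ (law p X)
  law0 law_ge0 law_sigma_additive.

Let law_setT : law p X [set: T] = 1.
Proof. by rewrite /law preimage_setT pvector_sum1. Qed.

HB.instance Definition _ :=
  @Measure_isProbability.Build _ _ R (law p X) law_setT.

End law.

Section poisson_pvector.
Context (R : realType) (r : R).

Let poisson_mass_ge0 (k : nat) : 0 <= fine (poisson_prob r 0 [set k]).
Proof. exact: fine_ge0. Qed.

Let poisson_mass_sum1 :
  \esum_(k in [set: nat]) (fine (poisson_prob r 0 [set k]))%:E = 1%E.
Proof.
pose P : probability nat R := poisson_prob r 0.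
rewrite (_ : (fun k => _) = fun k => P [set k]); last first.
  by apply/funext => k; rewrite fineK// fin_num_measure.
rewrite -(probability_setT P) -nneseries_esumT//.
rewrite -(@measure_semi_bigcup _ _ _ P (fun k => [set k]))//.
- by congr (P _); apply/seteqP; split => // k _; exists k.
- by apply/trivIsetP => i j _ _ ij; apply/seteqP; split => // k [/= -> /eqP];
    rewrite (negbTE ij).
Qed.

(* Not [poisson_pmf r], which is constantly 1 when r = 0: Poi(0) has to be
   the Dirac mass at 0, as [poisson_prob 0] is. *)
Definition poisson_pvector : pvector R nat :=
  PVector poisson_mass_ge0 poisson_mass_sum1.

End poisson_pvector.

Section independent.
Context (R : realType).

Lemma esumZ (T : choiceType) (a : T -> \bar R) (c : R) : 0 <= c ->
  (forall t, 0 <= a t)%E ->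
  (\esum_(t in [set: T]) (c%:E * a t) = c%:E * \esum_(t in [set: T]) a t)%E.
Proof.
move=> c0 a0; rewrite /esum -ereal_supZl//; last first.
  by apply/set0P; exists 0%E; exists set0;
    [exact: fsets_set0|rewrite fsbig_set0].
congr ereal_sup; rewrite image_comp; apply: eq_imagel => F [finF _] /=.
by rewrite ge0_mule_fsumr.
Qed.

Lemma esum_prod_tuple (T : choiceType) n (q : 'I_n -> pvector R T) :
  \esum_(t in [set: n.-tuple T]) (\prod_(j < n) q j (tnth t j))%:E = 1%E.
Proof.
elim: n q => [|n IH] q.
  rewrite (_ : setT = [set [tuple]]); last first.
    by apply/seteqP; split => // t _; rewrite /= [t]tuple0.
  by rewrite esum_set1 ?big_ord0// lee_fin big_ord0.
pose e (xt : T * n.-tuple T) : n.+1.-tuple T := [tuple of xt.1 :: xt.2].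
have q0 m (q' : 'I_m -> pvector R T) (t : m.-tuple T) :
    0 <= \prod_(j < m) q' j (tnth t j).
  by apply: prodr_ge0 => j _; exact: pvector_ge0.
rewrite (@reindex_esum _ _ _ ([set: T] `*`` (fun=> [set: n.-tuple T])) _ e).
  transitivity (\esum_(x in [set: T]) \esum_(t in [set: n.-tuple T])
      ((q ord0 x)%:E * (\prod_(j < n) q (lift ord0 j) (tnth t j))%:E))%E.
    rewrite (@esum_esum R T (n.-tuple T) setT (fun=> setT)).
      apply: eq_esum => -[x t] _ /=; rewrite big_ord_recl EFinM.
      by congr (_ * (_)%:E)%E; apply: eq_bigr => j _; rewrite tnthS.
    by move=> x t _ _; rewrite mule_ge0// lee_fin ?pvector_ge0.
  rewrite -[RHS](pvector_sum1 (q ord0)); apply: eq_esum => x _.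
  rewrite esumZ ?pvector_ge0//; last by move=> t; rewrite lee_fin.
  by rewrite (IH (fun j => q (lift ord0 j))) mule1.
split => //.
  by move=> [x t] [y s] _ _ /(congr1 val)/= [-> ts]; congr (_, _); apply: val_inj.
by move=> t _ /=; exists (thead t, [tuple of behead t]) => //; rewrite [RHS]tuple_eta.
Qed.

Context (I : finType) (T : choiceType) (p : I -> pvector R T).

Let prod_ge0 (u : {ffun I -> T}) : 0 <= \prod_i p i (u i).
Proof. by apply: prodr_ge0 => i _; exact: pvector_ge0. Qed.

Let prod_sum1 :
  \esum_(u in [set: {ffun I -> T}]) (\prod_i p i (u i))%:E = 1%E.
Proof.
rewrite -(esum_prod_tuple (fun j : 'I_#|I| => p (enum_val j))).
pose e (t : #|I|.-tuple T) : {ffun I -> T} := Finfun t.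
rewrite (@reindex_esum _ _ _ [set: #|I|.-tuple T] _ e).
  apply: eq_esum => t _; rewrite (reindex _ (onW_bij _ (@enum_val_bij I)))/=.
  by congr (_%:E); apply: eq_bigr => j _; rewrite ffunE enum_valK.
split => //; first by move=> t s _ _ /(congr1 fgraph); rewrite !FinfunK.
by move=> u _; exists (fgraph u) => //; exact: fgraphK.
Qed.

(* The joint law of independent variables u(i) of laws p(i). *)
Definition indep_pvector : pvector R {ffun I -> T} :=
  PVector prod_ge0 prod_sum1.

End independent.

Section histogram.
Context (Y : finType).

Definition histogram : Type := {ffun Y -> int}.

HB.instance Definition _ := GRing.Zmodule.on histogram.
HB.instance Definition _ := isPointed.Build histogram 0.
HB.instance Definition _ := @isMeasurable.Build default_measure_display
  histogram discrete_measurable discrete_measurable0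
  discrete_measurableC discrete_measurableU.

Definition basis_vec (y : Y) : histogram := [ffun z => (z == y)%:Z].

Definition count_hist n (m : {ffun 'I_n -> Y}) : histogram :=
  [ffun y => #|[pred i | m i == y]|%:Z].

End histogram.

Section statistical_experiments.
Context (R : realType).
Local Open Scope ereal_scope.

Definition tv d (T : measurableType d) (mu nu : set T -> \bar R) : \bar R :=
  ereal_sup [set `|mu A - nu A| | A in measurable].

Definition kernel_image d d' (T : measurableType d) (T' : measurableType d')
    (P : probability T R) (K : R.-pker T ~> T') (B : set T') : \bar R :=
  \int[P]_t K t B.

Definition deficiency d d' (T : measurableType d) (T' : measurableType d')
    (P Q : probability T R) (P' Q' : probability T' R) : \bar R :=
  ereal_inf [set maxe (tv (kernel_image P K) P') (tv (kernel_image Q K) Q') |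
             K in [set: R.-pker T ~> T']].

Definition le_cam d d' (T : measurableType d) (T' : measurableType d')
    (P Q : probability T R) (P' Q' : probability T' R) : \bar R :=
  maxe (deficiency P Q P' Q') (deficiency P' Q' P Q).

(* [privacy_curve Q P] is the curve of Q against P, in this order. *)
Definition privacy_curve d (T : measurableType d) (Q P : probability T R)
    (eps : R) : \bar R :=
  ereal_sup [set Q A - (expR eps)%:E * P A | A in measurable].

End statistical_experiments.

Section shuffle_model.
Context (R : realType) (Y : finType).

(* Inputs are booleans: false is 0 and true is 1. *)
Definition dominant (y0 y1 : Y) (b : bool) : Y := if b then y1 else y0.

(* The values alpha b (dominant y0 y1 b) are unconstrained and irrelevant. *)
Definition sparse_error_critical (W : nat -> bool -> pvector R Y)
    (y0 y1 : Y) (alpha : bool -> Y -> R) :=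
  [/\ y0 != y1,
      forall b y, y != dominant y0 y1 b -> 0 <= alpha b y,
      forall b y, y != dominant y0 y1 b ->
        (fun n => n%:R * W n b y) @ \oo --> alpha b y &
      forall b, (fun n => W n b (dominant y0 y1 b)) @ \oo --> (1 : R)].

(* The law of the messages of n users under T_{n,k}. The order of the users is
   irrelevant to the histogram; the first k of them have input 1. *)
Definition messages n (w : bool -> pvector R Y) (k : nat) :
    pvector R {ffun 'I_n -> Y} :=
  indep_pvector (fun i : 'I_n => w (i < k)%N).

Definition centered_hist n (y0 y1 : Y) (k : nat) (m : {ffun 'I_n -> Y}) :
    histogram Y :=
  count_hist m - basis_vec y0 *+ (n - k) - basis_vec y1 *+ k.

(* The law under T_{n,l} of the histogram centered using k. *)
Definition centered_law n (w : bool -> pvector R Y) (y0 y1 : Y)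
    (k l : nat) : probability (histogram Y) R :=
  law (messages n w l) (@centered_hist n y0 y1 k).

Definition input_weight (q : R) (b : bool) : R := if b then q else 1 - q.

(* Independent Poisson variables: u(false, y) is U_y and u(true, y) is V_y. The
   coordinates u(b, dominant y0 y1 b) are not used by [limit_hist]. *)
Definition poisson_family (alpha : bool -> Y -> R) (q : R) :
    pvector R {ffun bool * Y -> nat} :=
  indep_pvector (fun i : bool * Y =>
    poisson_pvector (input_weight q i.1 * alpha i.1 i.2)).

Definition limit_hist (y0 y1 : Y) (u : {ffun bool * Y -> nat}) :
    histogram Y :=
  \sum_(y | y != y0) (basis_vec y - basis_vec y0) *+ u (false, y) +
  \sum_(y | y != y1) (basis_vec y - basis_vec y1) *+ u (true, y).

Definition limit_law0 (y0 y1 : Y) (alpha : bool -> Y -> R) (q : R) :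
    probability (histogram Y) R :=
  law (poisson_family alpha q) (limit_hist y0 y1).

Definition limit_law1 (y0 y1 : Y) (alpha : bool -> Y -> R) (q : R) :
    probability (histogram Y) R :=
  law (poisson_family alpha q)
    (fun u => limit_hist y0 y1 u + basis_vec y1 - basis_vec y0).

End shuffle_model.

(* Main.v *)
Require Import Defs.
From HB Require Import structures.
From mathcomp Require Import all_boot all_order all_algebra.
From mathcomp Require Import all_classical all_reals all_analysis.
From mathcomp Require Import ring lra.
Set Implicit Arguments.
Unset Strict Implicit.
Unset Printing Implicit Defensive.
Import Order.TTheory GRing.Theory Num.Theory.
Import numFieldNormedType.Exports.
Local Open Scope classical_set_scope.
Local Open Scope ring_scope.

(** Histograms under T_{n,l} and their Poisson limit are both sums of independent
    variables in the group of integer vectors indexed by [Y], so their laws are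
    products in the commutative convolution monoid of probability mass functions,
    where total variation errors add up (Le Cam's method):
    - a user with input b, who errs with probability s = O(1/n), is within s^2 of
      the product over y of the laws of Poi(W_b(y)) (e_y - e_{y_b});
    - Poisson laws with the same jump multiply by adding their rates, so the n users
      together are within n O(1/n^2) of Poisson laws with rates n_b W_b(y), where
      n_b users have input b;
    - changing a Poisson rate r into s costs at most |r - s|, which is O(1/n) here.
    The law under T_{n,k+1} centered using k is the one centered using k+1 shifted by
    e_{y1} - e_{y0}, hence is treated the same way. The identity kernel then bounds
    both deficiencies by total variation. *)

(** * Probability mass functions and their expectations *)

Section expectation.
Context (R : realType).
Implicit Types T S : choiceType.

(** Total variation is tested on functions with values in $[0,1]$ instead of events: unlike
    indicators, they are stable under integrating out one of two independent variables
    ([test_expect]). *)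
Definition test_fun (U : Type) (f : U -> R) := forall t, 0 <= f t <= 1.

Definition expect T (p : pvector R T) (f : T -> R) : R :=
  fine (\esum_(t in [set: T]) (p t * f t)%:E).

Lemma pvector_ext T (p q : pvector R T) : p =1 q -> p = q.
Proof.
case: p q => [p p0 p1] [q q0 q1] /= /funext pq.
by case: _ / pq in q0 q1 *; congr PVector; exact: Prop_irrelevance.
Qed.

Lemma test_comp (U V : Type) (f : V -> R) (X : U -> V) :
  test_fun f -> test_fun (fun u => f (X u)).
Proof. by move=> f01 u; exact: f01. Qed.

Lemma test_compl (U : Type) (f : U -> R) :
  test_fun f -> test_fun (fun u => 1 - f u).
Proof. by move=> f01 u; move: (f01 u); lra. Qed.

Lemma test_indic (U : Type) (A : set U) : test_fun (\1_A : U -> R).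
Proof. by move=> u; rewrite indicE; case: (u \in A); rewrite ?lexx ?ler01. Qed.

Lemma test_cst (U : Type) (c : R) : 0 <= c <= 1 -> test_fun (fun _ : U => c).
Proof. by move=> c01 u. Qed.

Section one_variable.
Context T (p : pvector R T).
Implicit Types f g : T -> R.

Lemma esum_pvector_cst (c : R) : 0 <= c ->
  \esum_(t in [set: T]) (p t * c)%:E = c%:E.
Proof.
move=> c0; under eq_esum do rewrite mulrC EFinM.
by rewrite esumZ ?pvector_sum1 ?mule1// => t; rewrite lee_fin pvector_ge0.
Qed.

Lemma expectE f : test_fun f ->
  (expect p f)%:E = \esum_(t in [set: T]) (p t * f t)%:E.
Proof.
move=> f01; rewrite fineK// ge0_fin_numE; last first.
  by apply: esum_ge0 => t _; rewrite lee_fin mulr_ge0 ?pvector_ge0//; case/andP: (f01 t).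
apply: (@le_lt_trans _ _ 1%E); last exact: ltry.
rewrite -(pvector_sum1 p); apply: le_esum => t _; rewrite lee_fin ler_piMr ?pvector_ge0//.
by case/andP: (f01 t).
Qed.

Lemma expect_cst (c : R) : 0 <= c -> expect p (fun=> c) = c.
Proof. by move=> c0; rewrite /expect esum_pvector_cst. Qed.

Lemma mul_test_ge0 f : test_fun f -> forall t, (0 <= (p t * f t)%:E)%E.
Proof. by move=> f01 t; rewrite lee_fin mulr_ge0 ?pvector_ge0//; case/andP: (f01 t). Qed.

Lemma expect_leD f g (c : R) : test_fun f -> test_fun g -> 0 <= c ->
  (forall t, f t <= g t + c) -> expect p f <= expect p g + c.
Proof.
move=> f01 g01 c0 fg; rewrite -lee_fin EFinD !expectE//.
rewrite -[X in (_ + X)%E]esum_pvector_cst// -esumD; first last.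
- by move=> t _; rewrite lee_fin mulr_ge0 ?pvector_ge0.
- by move=> t _; exact: mul_test_ge0.
by apply: le_esum => t _; rewrite -EFinD lee_fin -mulrDr ler_wpM2l ?pvector_ge0.
Qed.

Lemma expect_compl f : test_fun f -> expect p (fun t => 1 - f t) = 1 - expect p f.
Proof.
move=> f01; apply/(addIr (expect p f)); rewrite subrK.
apply/EFin_inj; rewrite EFinD !expectE//; last exact: test_compl.
have g01 := test_compl f01.
rewrite -esumD; first last.
- by move=> t _; exact: mul_test_ge0.
- by move=> t _; exact: mul_test_ge0 g01 t.
rewrite -[RHS](pvector_sum1 p).
by apply: eq_esum => t _; rewrite -EFinD -mulrDr subrK mulr1.
Qed.

Lemma test_expect (U : Type) (f : U -> T -> R) : (forall u, test_fun (f u)) ->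
  test_fun (fun u => expect p (f u)).
Proof.
move=> f01 u; apply/andP; split; rewrite -lee_fin expectE//.
  by apply: esum_ge0 => t _; exact: mul_test_ge0.
rewrite -(esum_pvector_cst ler01); apply: le_esum => t _.
by rewrite lee_fin ler_wpM2l ?pvector_ge0//; case/andP: (f01 u t).
Qed.

Lemma expect_ge_seq f (s : seq T) : test_fun f -> uniq s ->
  \sum_(t <- s) p t * f t <= expect p f.
Proof.
move=> f01 us; rewrite -lee_fin expectE// -sumEFin.
apply: esum_ge; exists [set` s]; first by split => //.
by rewrite fsbig_seq.
Qed.

Lemma expect_set1 t : expect p \1_[set t] = p t.
Proof.
apply/EFin_inj; rewrite expectE; last exact: test_indic.
rewrite -(@esum_set1 R T t (fun t => (p t)%:E)); last by rewrite lee_fin pvector_ge0.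
rewrite [RHS]esum_mkcond; apply: eq_esum => s _.
by rewrite indicE; case: (s \in _); rewrite ?mulr1 ?mulr0.
Qed.

End one_variable.

(** Indicators of singletons recover the masses. Identities between laws are thereby reduced to
    computing expectations. *)
Lemma expect_ext T (p q : pvector R T) :
  (forall f, test_fun f -> expect p f = expect q f) -> p = q.
Proof.
move=> pq; apply: pvector_ext => t.
by rewrite -!expect_set1 pq//; exact: test_indic.
Qed.

Lemma expect_supp (T : choiceType) (p : pvector R T) f (s : seq T) :
  test_fun f -> uniq s -> (forall t, t \notin s -> f t = 0) ->
  expect p f = \sum_(t <- s) p t * f t.
Proof.
move=> f01 us fs; apply/EFin_inj; rewrite expectE// -sumEFin fsbig_seq//.
rewrite -esum_fset; [|exact: finite_seq|by move=> t _; exact: mul_test_ge0].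
rewrite [RHS]esum_mkcond; apply: eq_esum => t _; case: ifPn => //.
by rewrite notin_setE => /negP/fs ->; rewrite mulr0.
Qed.

Lemma expect_fin (T : finType) (p : pvector R T) f : test_fun f ->
  expect p f = \sum_t p t * f t.
Proof.
move=> f01; apply: expect_supp => //; first exact: index_enum_uniq.
by move=> t; rewrite mem_index_enum.
Qed.

Section product.
Context T S (p : pvector R T) (q : pvector R S).

Let mass_ge0 (u : T * S) : 0 <= p u.1 * q u.2.
Proof. by rewrite mulr_ge0 ?pvector_ge0. Qed.

(** Tonelli for nonnegative terms, proved before the product law exists: $f=1$ gives the total mass
    needed to define [prod_pvector], and a general $f$ then gives [expect_prod]. *)
Let esum_product (f : T * S -> R) : test_fun f ->
  \esum_(u in [set: T * S]) (p u.1 * q u.2 * f u)%:E =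
  \esum_(t in [set: T]) (p t * expect q (fun s => f (t, s)))%:E.
Proof.
move=> f01; have f01' t : test_fun (fun s => f (t, s)) by move=> s.
transitivity (\esum_(t in [set: T]) \esum_(s in [set: S]) (p t * (q s * f (t, s)))%:E).
  rewrite (@esum_esum R T S setT (fun=> setT)); last first.
    by move=> t s _ _; rewrite lee_fin mulrA mulr_ge0 ?mulr_ge0 ?pvector_ge0//;
      case/andP: (f01 (t, s)).
  rewrite (_ : _ `*`` _ = setT); last by apply/seteqP; split.
  by apply: eq_esum => -[t s] _ /=; rewrite mulrA.
apply: eq_esum => t _; rewrite EFinM expectE//.
under eq_esum do rewrite EFinM.
by rewrite esumZ ?pvector_ge0// => s; exact: (mul_test_ge0 q (f01' t)).
Qed.

Let mass_sum1 : \esum_(u in [set: T * S]) (p u.1 * q u.2)%:E = 1%E.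
Proof.
under eq_esum do rewrite -[X in X%:E]mulr1.
rewrite (@esum_product (fun=> 1)); last by apply: test_cst; rewrite ler01 lexx.
by rewrite expect_cst// esum_pvector_cst.
Qed.

Definition prod_pvector : pvector R (T * S)%type := PVector mass_ge0 mass_sum1.

Lemma expect_prod f : test_fun f ->
  expect prod_pvector f = expect p (fun t => expect q (fun s => f (t, s))).
Proof.
move=> f01; apply/EFin_inj; rewrite !expectE ?esum_product//.
by apply: test_expect => t s.
Qed.

End product.

Section pushforward.
Context T S (p : pvector R T) (X : T -> S).

Let mass (s : S) : R := expect p (fun t => \1_[set s] (X t)).

Let mass_ge0 s : 0 <= mass s.
Proof.
have s01 : test_fun (fun t => \1_[set s] (X t) : R) by exact/test_comp/test_indic.
by have /andP[] := @test_expect T p unit _ (fun=> s01) tt.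
Qed.

(** The sum is split over the fibres of [X]. As for products, $f=1$ gives the total mass and a
    general $f$ the expectation. *)
Let esum_mass f : test_fun f ->
  \esum_(s in [set: S]) (mass s * f s)%:E = \esum_(t in [set: T]) (p t * f (X t))%:E.
Proof.
move=> f01; have f0 t : 0 <= f t by case/andP: (f01 t).
transitivity (\esum_(s in [set: S]) \esum_(t in X @^-1` [set s]) (p t * f (X t))%:E).
  apply: eq_esum => s _.
  have s01 : test_fun (fun t => \1_[set s] (X t) : R) by exact/test_comp/test_indic.
  rewrite mulrC EFinM expectE// -esumZ//; last by move=> t; exact: (mul_test_ge0 p s01 t).
  rewrite [RHS]esum_mkcond; apply: eq_esum => t _; rewrite -EFinM indicE.
  have [/set_mem/= ->|] := boolP (t \in X @^-1` [set s]).
    by rewrite mem_set//= mulr1 mulrC.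
  by rewrite notin_setE/= => tX; rewrite memNset//= mulr0 mulr0.
rewrite (@esum_esum R S T setT (fun s => X @^-1` [set s])); last first.
  by move=> s t _ _; rewrite lee_fin mulr_ge0 ?pvector_ge0.
(* The pairs $(s,t)$ with $X(t)=s$ form the graph of [X], which $t$ parametrizes. *)
rewrite (@reindex_esum _ _ _ [set: T] _ (fun t => (X t, t))).
  by [].
split => //; first by move=> t t' _ _ [].
by move=> [s t] [_ /= <-]; exists t.
Qed.

Let mass_sum1 : \esum_(s in [set: S]) (mass s)%:E = 1%E.
Proof.
under eq_esum do rewrite -[X in X%:E]mulr1.
by rewrite (@esum_mass (fun=> 1)) ?esum_pvector_cst//; apply: test_cst; rewrite ler01 lexx.
Qed.

Definition push_pvector : pvector R S := PVector mass_ge0 mass_sum1.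

Lemma expect_push f : test_fun f ->
  expect push_pvector f = expect p (fun t => f (X t)).
Proof.
move=> f01; apply/EFin_inj; rewrite !expectE ?esum_mass//; exact: test_comp.
Qed.

End pushforward.

Section dirac.
Context T (t0 : T).

Let mass_ge0 (t : T) : 0 <= (t == t0)%:R :> R.
Proof. exact: ler0n. Qed.

Let mass_sum f : test_fun f ->
  \esum_(t in [set: T]) ((t == t0)%:R * f t)%:E = (f t0)%:E.
Proof.
move=> f01.
rewrite -(@esum_set1 R T t0 (fun t => (f t)%:E)); last by rewrite lee_fin; case/andP: (f01 t0).
rewrite [RHS]esum_mkcond; apply: eq_esum => t _.
have [->|tt0] := eqVneq t t0; first by rewrite mul1r mem_set.
by rewrite mul0r memNset//=; apply/eqP.
Qed.

Let mass_sum1 : \esum_(t in [set: T]) ((t == t0)%:R%:E : \bar R) = 1%E.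
Proof.
under eq_esum do rewrite -[X in X%:E]mulr1.
by rewrite (@mass_sum (fun=> 1))//; apply: test_cst; rewrite ler01 lexx.
Qed.

Definition dirac_pvector : pvector R T := PVector mass_ge0 mass_sum1.

Lemma expect_dirac f : test_fun f -> expect dirac_pvector f = f t0.
Proof. by move=> f01; apply/EFin_inj; rewrite expectE//= mass_sum. Qed.

End dirac.

Lemma expect_swap T S (p : pvector R T) (q : pvector R S) (f : T -> S -> R) :
  (forall t, test_fun (f t)) ->
  expect p (fun t => expect q (f t)) = expect q (fun s => expect p (f ^~ s)).
Proof.
move=> f01; pose F u := f u.1 u.2; pose G u := f u.2 u.1.
have F01 : test_fun F by move=> [t s]; exact: f01.
have G01 : test_fun G by move=> [t s]; exact: f01.
rewrite -(@expect_prod _ _ p q F)// -(@expect_prod _ _ q p G)//.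
apply/EFin_inj; rewrite !expectE//.
rewrite (@reindex_esum _ _ _ [set: S * T] _ (fun u => (u.2, u.1))).
  by apply: eq_esum => -[s t] _ /=; rewrite (mulrC (p t)).
split => //; first by move=> [? ?] [? ?] _ _ [-> ->].
by move=> [t s] _; exists (s, t).
Qed.

Lemma law_expect T d (S : measurableType d) (p : pvector R T) (X : T -> S) A :
  law p X A = (expect p (fun t => \1_A (X t)))%:E.
Proof.
rewrite expectE; last exact/test_comp/test_indic.
rewrite /law esum_mkcond; apply: eq_esum => t _.
rewrite indicE (_ : (t \in X @^-1` A) = (X t \in A)); last by apply/idP/idP; rewrite !inE.
by case: ifP; rewrite ?mulr1 ?mulr0.
Qed.

End expectation.

(** * Convolution of laws on an abelian group *)

Section convolution.
Context (R : realType) (G : zmodType).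
Implicit Types p q : pvector R G.

Definition convolve p q : pvector R G :=
  push_pvector (prod_pvector p q) (fun u => u.1 + u.2).

Lemma expect_convolve p q f : test_fun f ->
  expect (convolve p q) f = expect p (fun x => expect q (fun y => f (x + y))).
Proof.
move=> f01; rewrite expect_push// expect_prod//; exact: (test_comp _ f01).
Qed.

Lemma convolveC : commutative convolve.
Proof.
move=> p q; apply: expect_ext => f f01; rewrite !expect_convolve//.
rewrite expect_swap; last by move=> x y; exact: f01.
by congr expect; apply/funext => x; congr expect; apply/funext => y; rewrite addrC.
Qed.

Lemma convolveA : associative convolve.
Proof.
move=> p q r; apply: expect_ext => f f01; rewrite !expect_convolve//; last first.
  by apply: test_expect => x y; exact: f01.
congr expect; apply/funext => x; rewrite expect_convolve; last by move=> y; exact: f01.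
by congr expect; apply/funext => y; congr expect; apply/funext => z; rewrite addrA.
Qed.

Lemma convolve0p : left_id (dirac_pvector R 0) convolve.
Proof.
move=> p; apply: expect_ext => f f01; rewrite expect_convolve// expect_dirac.
  by congr expect; apply/funext => x; rewrite add0r.
by apply: test_expect => x y; exact: f01.
Qed.

(** With this structure the big operator lemmas on regrouping and exchanging apply to products of
    laws. *)
HB.instance Definition _ :=
  Monoid.isComLaw.Build _ (dirac_pvector R 0) convolve convolveA convolveC convolve0p.

(** Induction on $n$, splitting off the first coordinate $x$. The induction hypothesis is applied to
    $y\mapsto f(X_0(x)+y)$, so it has to hold for all test functions. *)
Lemma esum_tuple_convolve T n (p : 'I_n -> pvector R T) (X : 'I_n -> T -> G) f :
  test_fun f ->
  \esum_(t in [set: n.-tuple T])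
    (\prod_j p j (tnth t j) * f (\sum_j X j (tnth t j)))%:E =
  (expect (\big[convolve/dirac_pvector R 0]_j push_pvector (p j) (X j)) f)%:E.
Proof.
elim: n p X f => [|n IH] p X f f01.
  rewrite (_ : setT = [set [tuple]]); last first.
    by apply/seteqP; split => // t _; rewrite /= [t]tuple0.
  rewrite esum_set1 ?big_ord0 ?mul1r ?expect_dirac ?big_ord0// lee_fin.
  by case/andP: (f01 0).
pose e (xt : T * n.-tuple T) : n.+1.-tuple T := [tuple of xt.1 :: xt.2].
have q0 m (q' : 'I_m -> pvector R T) (t : m.-tuple T) :
    0 <= \prod_(j < m) q' j (tnth t j).
  by apply: prodr_ge0 => j _; exact: pvector_ge0.
have f0 x : 0 <= f x by case/andP: (f01 x).
rewrite (@reindex_esum _ _ _ ([set: T] `*`` (fun=> [set: n.-tuple T])) _ e); last first.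
  split => //.
    by move=> [x t] [y s] _ _ /(congr1 val)/= [-> ts]; congr (_, _); apply: val_inj.
  by move=> t _ /=; exists (thead t, [tuple of behead t]) => //; rewrite [RHS]tuple_eta.
rewrite big_ord_recl expect_convolve// expect_push; last first.
  by apply: test_expect => x y; exact: f01.
rewrite expectE; last by apply: test_expect => x y; exact: f01.
transitivity (\esum_(x in [set: T]) \esum_(t in [set: n.-tuple T])
    ((p ord0 x)%:E * (\prod_(j < n) p (lift ord0 j) (tnth t j) *
      f (X ord0 x + \sum_j X (lift ord0 j) (tnth t j)))%:E))%E.
  rewrite (@esum_esum R T (n.-tuple T) setT (fun=> setT)).
    apply: eq_esum => -[x t] _ /=; rewrite !big_ord_recl -EFinM mulrA.
    by congr ((_ * _ * f (_ + _))%:E); apply: eq_bigr => j _; rewrite tnthS.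
  by move=> x t _ _; rewrite mule_ge0// lee_fin ?mulr_ge0 ?pvector_ge0.
apply: eq_esum => x _.
rewrite esumZ ?pvector_ge0//; last by move=> t; rewrite lee_fin mulr_ge0.
by rewrite (IH _ (fun j => X (lift ord0 j)) (fun y => f (X ord0 x + y)))// => y; exact: f01.
Qed.

(** An enumeration of [I] turns families into tuples, where [esum_tuple_convolve] applies. *)
Lemma push_indep_sum (I : finType) T (p : I -> pvector R T) (X : I -> T -> G) :
  push_pvector (indep_pvector p) (fun u => \sum_i X i (u i)) =
  \big[convolve/dirac_pvector R 0]_i push_pvector (p i) (X i).
Proof.
apply: expect_ext => f f01; apply/EFin_inj.
rewrite expect_push// expectE; last by move=> u; exact: f01.
rewrite (reindex _ (onW_bij _ (@enum_val_bij I)))/= -esum_tuple_convolve//.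
pose e (t : #|I|.-tuple T) : {ffun I -> T} := Finfun t.
rewrite (@reindex_esum _ _ _ [set: #|I|.-tuple T] _ e).
  apply: eq_esum => t _; congr ((_ * f _)%:E);
  rewrite (reindex _ (onW_bij _ (@enum_val_bij I)))/=;
  by apply: eq_bigr => j _; rewrite ffunE enum_valK.
split => //; first by move=> t s _ _ /(congr1 fgraph); rewrite !FinfunK.
by move=> u _; exists (fgraph u) => //; exact: fgraphK.
Qed.

End convolution.

(** * Total variation bounds and their behaviour under convolution *)

Section total_variation.
Context (R : realType).

(** One inequality suffices: applied to $1-f$ it gives the reverse one ([tv_within_sym]). *)
Definition tv_within (T : choiceType) (c : R) (p q : pvector R T) :=
  forall f, test_fun f -> expect p f <= expect q f + c.

Section general.
Context (T : choiceType).
Implicit Types p q : pvector R T.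

Lemma tv_within_ge0 c p q : tv_within c p q -> 0 <= c.
Proof.
move=> /(_ (fun=> 0)); rewrite !expect_cst// add0r; apply.
by apply: test_cst; rewrite lexx ler01.
Qed.

Lemma tv_within_refl p : tv_within 0 p p.
Proof. by move=> f f01; rewrite addr0. Qed.

Lemma tv_within_sym c p q : tv_within c p q -> tv_within c q p.
Proof.
move=> pq f f01; have := pq _ (test_compl f01).
by rewrite !expect_compl//; lra.
Qed.

Lemma tv_within_trans c c' p q r :
  tv_within c p q -> tv_within c' q r -> tv_within (c + c') p r.
Proof. by move=> pq qr f f01; have := pq f f01; have := qr f f01; lra. Qed.

Lemma tv_within_le c c' p q : c <= c' -> tv_within c p q -> tv_within c' p q.
Proof. by move=> cc' pq f f01; have := pq f f01; lra. Qed.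

End general.

Context (G : zmodType).

(** The factors are replaced one at a time. With the left summand fixed at $x$, $y\mapsto f(x+y)$ is
    a test function, so the bound on the right factors applies; commutativity handles the left
    ones. *)
Lemma tv_within_convolve c c' (p p' q q' : pvector R G) :
  tv_within c p p' -> tv_within c' q q' ->
  tv_within (c + c') (convolve p q) (convolve p' q').
Proof.
have right d (r s s' : pvector R G) : tv_within d s s' ->
    tv_within d (convolve r s) (convolve r s').
  move=> ss' f f01; rewrite !expect_convolve//.
  apply: expect_leD; rewrite ?(tv_within_ge0 ss')//.
  - by apply: test_expect => x y; exact: f01.
  - by apply: test_expect => x y; exact: f01.
  - by move=> x; apply: ss' => y; exact: f01.
move=> pp' qq'; apply: (@tv_within_trans _ _ _ _ (convolve p' q)); last exact: right.
by rewrite convolveC [convolve p' q]convolveC; exact: right.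
Qed.

Lemma tv_within_big (I : Type) (s : seq I) (P : pred I) c (p q : I -> pvector R G) :
  (forall i, P i -> tv_within (c i) (p i) (q i)) ->
  tv_within (\sum_(i <- s | P i) c i)
    (\big[@convolve R G/dirac_pvector R 0]_(i <- s | P i) p i)
    (\big[@convolve R G/dirac_pvector R 0]_(i <- s | P i) q i).
Proof.
move=> pq; apply: (big_rec3 (fun p q c => tv_within c q p)).
  exact: tv_within_refl.
by move=> i p' q' c' Pi; apply: tv_within_convolve; exact: pq.
Qed.

End total_variation.

(** * Poisson laws and Poisson approximation *)

Section poisson.
Context (R : realType).

(** At $r=0$ the law is the Dirac mass at $0$, and the formula still holds there because $0^0=1$. *)
Lemma poisson_pvectorE (r : R) k : 0 <= r ->
  poisson_pvector r k = r ^+ k / k`!%:R * expR (- r).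
Proof.
rewrite le_eqVlt => /predU1P[<-|r0] /=; rewrite /poisson_prob.
  rewrite ltxx diracE oppr0 expR0 mulr1 expr0n.
  have [->|k0] := eqVneq k 0%N; first by rewrite mem_set// fact0 divr1.
  by rewrite memNset ?mul0r//= => /esym/eqP; rewrite (negbTE k0).
by rewrite r0 esum_set1 ?lee_fin ?poisson_pmf_ge0// /poisson_pmf r0.
Qed.

(** The mass at $m$ is a sum over $i\le m$ of products of masses at $i$ and $m-i$, which is the
    binomial expansion of $(r+s)^m$. *)
Lemma poisson_add (r s : R) : 0 <= r -> 0 <= s ->
  push_pvector (prod_pvector (poisson_pvector r) (poisson_pvector s))
    (fun u => u.1 + u.2)%N = poisson_pvector (r + s).
Proof.
move=> r0 s0; apply: pvector_ext => m.
have m01 : test_fun (\1_[set m] : nat -> R) by exact: test_indic.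
rewrite -expect_set1 expect_push// expect_prod; last by move=> u; exact: m01.
have inner i : expect (poisson_pvector s) (fun j => \1_[set m] (i + j)%N) =
    if (i <= m)%N then poisson_pvector s (m - i)%N else 0.
  have [im|mi] := leqP i m.
    rewrite -[RHS]expect_set1; congr expect; apply/funext => j; rewrite !indicE.
    congr (nat_of_bool _)%:R; apply/idP/idP; rewrite !inE /=.
      by move=> <-; rewrite addKn.
    by move=> ->; rewrite subnKC.
  rewrite -[RHS](@expect_cst _ _ (poisson_pvector s))//; congr expect.
  apply/funext => j; rewrite indicE memNset//= => ijm.
  by move: mi; rewrite -ijm ltnNge leq_addr.
rewrite (@expect_supp _ _ _ _ (iota 0 m.+1)) ?iota_uniq//; first last.
- by move=> i; rewrite mem_iota/= add0n ltnS inner => /negbTE ->.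
- by apply: test_expect => i j; exact: m01.
rewrite -[m.+1]subn0 -/(index_iota 0 m.+1) big_mkord poisson_pvectorE ?addr_ge0//.
rewrite [in X in X ^+ _]addrC exprDn opprD expRD !mulr_suml; apply: eq_bigr => i _.
have im : (i <= m)%N by rewrite -ltnS.
rewrite inner im !poisson_pvectorE// -(bin_fact im) !natrM -mulr_natr.
have fact_neq0 k : k`!%:R != 0 :> R by rewrite pnatr_eq0 -lt0n fact_gt0.
have bin_neq0 : 'C(m, i)%:R != 0 :> R by rewrite pnatr_eq0 -lt0n bin_gt0.
by field; rewrite !fact_neq0 bin_neq0.
Qed.

Context (G : zmodType).

Definition poisson_mult (r : R) (v : G) : pvector R G :=
  push_pvector (poisson_pvector r) (fun k => v *+ k).

Lemma poisson_multD r s v : 0 <= r -> 0 <= s ->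
  poisson_mult (r + s) v = convolve (poisson_mult r v) (poisson_mult s v).
Proof.
move=> r0 s0; apply: expect_ext => f f01.
have f01' : test_fun (fun k => f (v *+ k)) by move=> k; exact: f01.
rewrite expect_convolve// /poisson_mult -poisson_add// !expect_push//; last first.
  by apply: test_expect => x y; exact: f01.
rewrite expect_prod; last by move=> u; exact: f01.
congr expect; apply/funext => i; rewrite expect_push; last by move=> y; exact: f01.
by congr expect; apply/funext => j; rewrite mulrnDr.
Qed.

Lemma poisson_mult0r v : poisson_mult 0 v = dirac_pvector R 0.
Proof.
apply: expect_ext => f f01; rewrite expect_push// expect_dirac//.
rewrite (_ : poisson_pvector 0 = dirac_pvector R 0%N); last first.
  apply: pvector_ext => k; rewrite poisson_pvectorE// oppr0 expR0 mulr1 expr0n /=.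
  by case: k => [|k]; rewrite ?fact0 ?divr1 ?mul0r.
by rewrite expect_dirac// => k; exact: f01.
Qed.

Lemma poisson_multr0 r : poisson_mult r 0 = dirac_pvector R 0.
Proof.
apply: expect_ext => f f01; rewrite expect_push// expect_dirac//.
under [X in expect _ X]funext do rewrite mul0rn.
by rewrite expect_cst//; case/andP: (f01 0).
Qed.

Lemma poisson_mult_sum (I : Type) (s : seq I) (P : pred I) (r : I -> R) v :
  (forall i, P i -> 0 <= r i) ->
  \big[@convolve R G/dirac_pvector R 0]_(i <- s | P i) poisson_mult (r i) v =
  poisson_mult (\sum_(i <- s | P i) r i) v.
Proof.
move=> r0.
(* Nonnegativity of the partial sums is carried through the induction, since [poisson_multD]
   requires it. *)
apply: (proj2 (A := 0 <= \sum_(i <- s | P i) r i)).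
apply: (big_rec2 (fun p t => 0 <= t /\ p = poisson_mult t v)).
  by rewrite poisson_mult0r.
by move=> i p t Pi [t0 ->]; rewrite addr_ge0 ?poisson_multD ?r0.
Qed.

(* Keeps only the outcomes with at most one jump. *)
Lemma expect_poisson_big_ge (I : Type) (s : seq I) (r : I -> R) (v : I -> G) f :
  (forall i, 0 <= r i) -> test_fun f ->
  expR (- \sum_(i <- s) r i) * (f 0 + \sum_(i <- s) r i * f (v i)) <=
  expect (\big[@convolve R G/dirac_pvector R 0]_(i <- s) poisson_mult (r i) (v i)) f.
Proof.
move=> r0; elim: s f => [|i s IH] f f01.
  by rewrite !big_nil addr0 oppr0 expR0 mul1r expect_dirac.
have tail01 x : test_fun (fun y => f (x + y)) by move=> y; exact: f01.
pose tail := \big[@convolve R G/dirac_pvector R 0]_(i <- s) poisson_mult (r i) (v i).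
have f0 x : 0 <= f x by case/andP: (f01 x).
rewrite !big_cons expect_convolve// expect_push; last exact: test_expect.
apply: le_trans (@expect_ge_seq _ _ _ _ [:: 0%N; 1%N] _ _) => //; last exact: test_expect.
rewrite big_cons big_seq1 !poisson_pvectorE//.
have := IH _ f01; have := IH _ (tail01 (v i)); rewrite -/tail.
rewrite (_ : (fun y => f (v i *+ 0 + y)) = f); last first.
  by apply/funext => y; rewrite add0r.
rewrite addr0 expr0 expr1 !divr1 mul1r opprD expRD.
set a := expR (- r i); set b := expR (- _); set S := \sum_(_ <- _) _ * _.
set S' := \sum_(_ <- _) _ * _.
have S0 : 0 <= S by apply: sumr_ge0 => j _; rewrite mulr_ge0.
have a0 : 0 <= a := expR_ge0 _; have b0 : 0 <= b := expR_ge0 _.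
move=> /(ler_wpM2l (mulr_ge0 (r0 i) a0)) h1 /(ler_wpM2l a0) h0.
(* The excess of the two bounds is the term in which both the head and the tail jump; it is
   nonnegative. *)
apply: le_trans (lerD h0 h1); have := mulr_ge0 (mulr_ge0 a0 b0) (mulr_ge0 (r0 i) S0).
by lra.
Qed.

(** With error probability $s$ and $t=\sum_{y\ne y_d}w_yf(v_y)\le s$, the left expectation is
    $(1-s)f(0)+t$, while the Poisson product has at least $e^{-s}(f(0)+t)\ge(1-s)(f(0)+t)$. The gap
    is at most $st\le s^2$. *)
Lemma tv_within_single_poisson (Y : finType) (w : pvector R Y) (v : Y -> G) (yd : Y) :
  v yd = 0 ->
  tv_within ((\sum_(y | y != yd) w y) ^+ 2) (push_pvector w v)
    (\big[@convolve R G/dirac_pvector R 0]_(y | y != yd) poisson_mult (w y) (v y)).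
Proof.
move=> vyd f f01; set s := \sum_(y | _) _.
have f0 x : 0 <= f x by case/andP: (f01 x).
have fle1 x : f x <= 1 by case/andP: (f01 x).
have w0 y : 0 <= w y by exact: pvector_ge0.
rewrite -big_filter expect_push// expect_fin; last by move=> y; exact: f01.
have := @expect_poisson_big_ge _ [seq y <- index_enum Y | y != yd] w v f w0 f01.
rewrite !big_filter -/s [X in _ -> X <= _](bigD1 yd)//= vyd.
have -> : w yd = 1 - s.
  have := @expect_fin R Y w (fun=> 1) (@test_cst R Y 1 _).
  rewrite lexx ler01 expect_cst// (bigD1 yd)//= mulr1 => /(_ isT).
  under eq_bigr do rewrite mulr1.
  by rewrite -/s => ->; rewrite addrK.
set t := \sum_(y | _) w y * f _ => poisson_ge.
have s0 : 0 <= s by exact: sumr_ge0.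
have t0 : 0 <= t by apply: sumr_ge0 => y _; rewrite mulr_ge0.
have ts : t <= s by apply: ler_sum => y _; rewrite ler_piMr.
have e1 : 1 - s <= expR (- s) by exact: expR_ge1Dx.
have e2 : (1 - s) * (f 0 + t) <= expR (- s) * (f 0 + t).
  by rewrite ler_wpM2r// addr_ge0.
have : s * t <= s ^+ 2 by rewrite expr2 ler_wpM2l.
by lra.
Qed.

(** For $r\le s$, the law of rate $s$ is that of rate $r$ convolved with that of rate $s-r$, and the
    Poisson count of the latter is $0$ with probability $e^{-(s-r)}\ge1-(s-r)$. *)
Lemma tv_within_poisson_mult r s v : 0 <= r -> 0 <= s ->
  tv_within `|r - s| (poisson_mult r v) (poisson_mult s v).
Proof.
wlog rs : r s / r <= s => [H r0 s0|r0 s0].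
  have [rs|/ltW sr] := leP r s; first exact: H.
  by apply: tv_within_sym; rewrite distrC; exact: H.
have d0 : 0 <= s - r by rewrite subr_ge0.
rewrite distrC ger0_norm//.
have -> : poisson_mult s v = convolve (poisson_mult r v) (poisson_mult (s - r) v).
  by rewrite -poisson_multD// [r + _]addrC subrK.
rewrite -[X in tv_within _ X _](Monoid.mulm1 (@convolve R G)).
rewrite -[X in tv_within X](add0r (s - r)).
apply: tv_within_convolve; first exact: tv_within_refl.
move=> f f01; rewrite expect_dirac//.
have := @expect_poisson_big_ge _ [:: tt] (fun=> s - r) (fun=> v) f (fun=> d0) f01.
rewrite !big_seq1.
have /andP[f0 f1] := f01 0; have /andP[fv0 _] := f01 v.
have e1 : 1 - (s - r) <= expR (- (s - r)) by exact: expR_ge1Dx.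
have e2 : expR (- (s - r)) * f 0 <= expR (- (s - r)) * (f 0 + (s - r) * f v).
  by rewrite ler_wpM2l ?expR_ge0// lerDl mulr_ge0.
have e3 : (1 - (s - r)) * f 0 <= expR (- (s - r)) * f 0 by rewrite ler_wpM2r.
have e4 : (s - r) * f 0 <= s - r by rewrite ler_piMr.
by lra.
Qed.

End poisson.

(** * Histograms as sums of independent displacements *)

Section histogram_approximation.
Context (R : realType) (Y : finType) (y0 y1 : Y).
Local Notation dom := (dominant y0 y1).

(** The change that a user with input [b] and output [y] makes to the centered histogram; it
    vanishes at the dominant output. *)
Definition displacement (b : bool) (y : Y) : histogram Y :=
  basis_vec y - basis_vec (dom b).

Definition users (n l : nat) (b : bool) : nat := if b then l else (n - l)%N.

Lemma card_users n l b : (l <= n)%N ->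
  #|[pred i : 'I_n | (i < l)%N == b]| = users n l b.
Proof.
move=> ln; have lt_card : #|[pred i : 'I_n | (i < l)%N]| = l.
  by rewrite -sum1_card -(big_ord_widen n (fun=> 1%N) ln) sum1_card card_ord.
case: b => /=; first by rewrite -[RHS]lt_card; apply: eq_card => i; rewrite !inE eqb_id.
rewrite -[in RHS]lt_card -[X in (X - _)%N](card_ord n) -(cardC [pred i : 'I_n | (i < l)%N]).
by rewrite addKn; apply: eq_card => i; rewrite !inE eqbF_neg.
Qed.

Definition user_error (w : bool -> pvector R Y) (b : bool) : R :=
  (\sum_(y | y != dom b) w b y) ^+ 2.

Definition rate_error (w : bool -> pvector R Y) alpha q n l (j : bool * Y) : R :=
  `|(users n l j.1)%:R * w j.1 j.2 - input_weight q j.1 * alpha j.1 j.2|.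

Lemma tv_within_histogram (w : bool -> pvector R Y) (alpha : bool -> Y -> R) (q : R) n l :
  (l <= n)%N -> 0 <= q <= 1 ->
  (forall b y, y != dom b -> 0 <= alpha b y) ->
  tv_within (\sum_(i < n) user_error w (i < l)%N +
             \sum_(j | j.2 != dom j.1) rate_error w alpha q n l j)
    (push_pvector (messages n w l) (fun m => \sum_(i < n) displacement (i < l)%N (m i)))
    (push_pvector (poisson_family alpha q)
       (fun u => \sum_(j : bool * Y) displacement j.1 j.2 *+ u j)).
Proof.
move=> ln /andP[q0 q1] alpha0.
have weight0 b : 0 <= input_weight q b by case: b; rewrite /= ?subr_ge0.
have disp0 b : displacement b (dom b) = 0 by rewrite /displacement subrr.
rewrite (push_indep_sum _ (fun (i : 'I_n) => displacement (i < l)%N)).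
rewrite (push_indep_sum _ (fun (j : bool * Y) k => displacement j.1 j.2 *+ k)).
(* The intermediate law: the users with input $b$ are merged into independent Poisson jumps of rate
   $n_bW_b(y)$. *)
pose users_poisson :=
  \big[@convolve R (histogram Y)/dirac_pvector R 0]_(j : bool * Y | j.2 != dom j.1)
    poisson_mult ((users n l j.1)%:R * w j.1 j.2) (displacement j.1 j.2).
apply: (@tv_within_trans _ _ _ _ _ users_poisson).
  have -> : users_poisson = \big[@convolve R (histogram Y)/dirac_pvector R 0]_(i < n)
      \big[@convolve R (histogram Y)/dirac_pvector R 0]_(y | y != dom (i < l)%N)
        poisson_mult (w (i < l)%N y) (displacement (i < l)%N y).
    (* Users are grouped by input; within a group all factors for a given $y$ have the same jump, so
       their rates add up. *)
    rewrite (partition_big (fun i : 'I_n => (i < l)%N) xpredT)//=.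
    rewrite /users_poisson -(pair_big_dep xpredT (fun b y => y != dom b)
      (fun b y => poisson_mult ((users n l b)%:R * w b y) (displacement b y)))/=.
    apply: eq_bigr => b _; symmetry.
    rewrite (eq_bigr (fun=> \big[@convolve R (histogram Y)/dirac_pvector R 0]_(y | y != dom b)
      poisson_mult (w b y) (displacement b y))); last by move=> i /eqP ->.
    rewrite exchange_big; apply: eq_bigr => y _.
    rewrite poisson_mult_sum; last by move=> *; exact: pvector_ge0.
    by rewrite sumr_const card_users// mulr_natl.
  by apply: tv_within_big => i _; exact: tv_within_single_poisson.
(* At dominant outputs the jump is $0$, so these factors of the limit are the unit of
   convolution. *)
rewrite [X in tv_within _ _ X](bigID (fun j => j.2 != dom j.1))/=.
rewrite [X in tv_within _ _ (convolve _ X)]big1; last first.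
  move=> [b y] /=; rewrite negbK => /eqP ->.
  by rewrite disp0; exact: poisson_multr0.
rewrite (Monoid.mulm1 (@convolve R (histogram Y))).
apply: tv_within_big => -[b y] yb; apply: tv_within_poisson_mult.
  by rewrite mulr_ge0 ?pvector_ge0.
by rewrite mulr_ge0 ?alpha0.
Qed.

Lemma count_histE n (m : {ffun 'I_n -> Y}) : count_hist m = \sum_i basis_vec (m i).
Proof.
apply/ffunP => y; rewrite ffunE sum_ffunE.
under [RHS]eq_bigr do rewrite ffunE eq_sym.
rewrite -sum1_card big_mkcond raddf_sum.
by apply: eq_bigr => i _ /=; rewrite inE; case: eqP.
Qed.

(** Centering by $k$ instead of $l$ leaves a deterministic shift, kept as two differences: both are
    $0$ for $l=k$, and they add up to $e_{y_1}-e_{y_0}$ for $l=k+1$. *)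
Lemma centered_histE n k l (m : {ffun 'I_n -> Y}) : (l <= n)%N ->
  centered_hist y0 y1 k m = \sum_(i < n) displacement (i < l)%N (m i) +
    (basis_vec y0 *+ (n - l) - basis_vec y0 *+ (n - k)) +
    (basis_vec y1 *+ l - basis_vec y1 *+ k).
Proof.
move=> ln; rewrite /centered_hist count_histE sumrB.
have -> : \sum_(i < n) basis_vec (dom (i < l)%N) =
    basis_vec y1 *+ l + basis_vec y0 *+ (n - l).
  rewrite (partition_big (fun i : 'I_n => (i < l)%N) xpredT)//= big_bool.
  congr (_ + _).
    rewrite (eq_bigr (fun=> basis_vec y1)) => [|i /eqP -> //].
    by rewrite sumr_const (card_users true).
  rewrite (eq_bigr (fun=> basis_vec y0)) => [|i /eqP -> //].
  by rewrite sumr_const (card_users false).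
move: (\sum_i _) (_ *+ _) (_ *+ _) (_ *+ _) (_ *+ _) => s a b a' b'.
by apply/ffunP => y; rewrite !ffunE; ring.
Qed.

(** Dominant outputs have displacement $0$, so the sum can run over all pairs, the index set of
    [poisson_family]. *)
Lemma limit_histE (u : {ffun bool * Y -> nat}) :
  limit_hist y0 y1 u = \sum_(j : bool * Y) displacement j.1 j.2 *+ u j.
Proof.
transitivity (\sum_b \sum_y displacement b y *+ u (b, y)); last first.
  by rewrite pair_bigA; apply: eq_bigr => -[].
rewrite /limit_hist addrC big_bool.
rewrite [X in _ = X + _](bigD1 y1)//= [X in _ = _ + X](bigD1 y0)//=.
by rewrite /displacement !subrr !mul0rn !add0r.
Qed.

End histogram_approximation.

(** * Deficiency and privacy curves controlled by total variation *)

Section experiments.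
Context (R : realType) d (T : measurableType d).
Implicit Types P Q : probability T R.
Local Open Scope ereal_scope.

Lemma tvC P Q : tv P Q = tv Q P.
Proof.
congr ereal_sup; apply: eq_imagel => A mA.
by rewrite -[P A]fineK ?fin_num_measure// -[Q A]fineK ?fin_num_measure//= distrC.
Qed.

Lemma tv_le P Q (c : R) :
  (forall A, measurable A -> P A <= Q A + c%:E) ->
  (forall A, measurable A -> Q A <= P A + c%:E) -> tv P Q <= c%:E.
Proof.
move=> PQ QP; apply: ge_ereal_sup => _ [A mA <-].
move: (PQ A mA) (QP A mA).
rewrite -[P A]fineK ?fin_num_measure// -[Q A]fineK ?fin_num_measure//=.
by rewrite -!EFinD !lee_fin ler_norml; lra.
Qed.

Lemma le_measure_tv P Q (c : R) A : tv P Q <= c%:E -> measurable A ->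
  (fine (P A) <= fine (Q A) + c)%R.
Proof.
move=> PQ mA; have : `|P A - Q A| <= c%:E.
  by apply: le_trans PQ; apply: ereal_sup_ubound; exists A.
rewrite -[P A]fineK ?fin_num_measure// -[Q A]fineK ?fin_num_measure//=.
by rewrite lee_fin ler_norml; lra.
Qed.

Lemma deficiency_le_tv P Q P' Q' :
  deficiency P Q P' Q' <= maxe (tv P P') (tv Q Q').
Proof.
(* The Dirac kernel of the identity map leaves every probability unchanged. *)
have image_id (S : probability T R) A : measurable A ->
    kernel_image S (kdirac (@measurable_id _ T setT)) A = S A.
  move=> mA; transitivity (\int[S]_t (\1_A t)%:E); first exact: eq_integral.
  by rewrite integral_indic// setIT.
apply: ereal_inf_lbound; exists (kdirac (@measurable_id _ T setT)) => //.
by congr maxe; congr ereal_sup; apply: eq_imagel => A mA; rewrite image_id.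
Qed.

Lemma le_cam_le_tv P Q P' Q' : le_cam P Q P' Q' <= maxe (tv P P') (tv Q Q').
Proof.
by rewrite ge_max deficiency_le_tv/= [tv P P']tvC [tv Q Q']tvC deficiency_le_tv.
Qed.

(** The empty set bounds the curve below by $0$, and $Q(A)\le1$ bounds it above. Finiteness allows
    curves to be subtracted as real numbers. *)
Lemma privacy_curve_fin_num Q P (eps : R) : privacy_curve Q P eps \is a fin_num.
Proof.
rewrite ge0_fin_numE; last first.
  by apply: ereal_sup_ubound; exists set0; rewrite ?measure0 ?mule0 ?sube0.
apply: (@le_lt_trans _ _ 1); last exact: ltry.
apply: ge_ereal_sup => _ [A mA <-]; apply: (@le_trans _ _ (Q A)); last exact: probability_le1.
by rewrite leeBlDr ?fin_numM ?fin_num_measure// leeDl// mule_ge0// lee_fin expR_ge0.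
Qed.

(** For each event, replacing $Q$ costs $c$ and replacing $P$ costs $e^{\varepsilon}c$. *)
Lemma privacy_curve_le_tv P Q P' Q' (c eps : R) : tv P P' <= c%:E -> tv Q Q' <= c%:E ->
  privacy_curve Q P eps <= privacy_curve Q' P' eps + (c * (1 + expR eps))%:E.
Proof.
rewrite [tv P P']tvC => PP' QQ'; apply: ge_ereal_sup => _ [A mA <-].
apply: (@le_trans _ _ (Q' A - (expR eps)%:E * P' A + (c * (1 + expR eps))%:E)).
  have := le_measure_tv PP' mA; have := le_measure_tv QQ' mA.
  rewrite -[P A]fineK ?fin_num_measure// -[Q A]fineK ?fin_num_measure//.
  rewrite -[P' A]fineK ?fin_num_measure// -[Q' A]fineK ?fin_num_measure//=.
  rewrite lee_fin => QA /(ler_wpM2l (expR_ge0 eps)) PA.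
  by lra.
by rewrite leeD2r//; apply: ereal_sup_ubound; exists A.
Qed.

Lemma privacy_curve_tv P Q P' Q' (c eps : R) : tv P P' <= c%:E -> tv Q Q' <= c%:E ->
  `|privacy_curve Q P eps - privacy_curve Q' P' eps| <= (c * (1 + expR eps))%:E.
Proof.
move=> PP' QQ'; have := privacy_curve_le_tv eps PP' QQ'.
have := @privacy_curve_le_tv P' Q' P Q c eps.
rewrite [tv P' P]tvC [tv Q' Q]tvC => /(_ PP' QQ').
rewrite -(fineK (privacy_curve_fin_num Q P eps)) -(fineK (privacy_curve_fin_num Q' P' eps)).
by rewrite -!EFinD !lee_fin ler_norml; lra.
Qed.

End experiments.

(** For an event $A$, $1_A\circ g$ is a test function on [G], so applying [g] does not increase the
    distance. This allows a common translation of both sides. *)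
Lemma tv_law_le (R : realType) (S S' G : choiceType) d (U : measurableType d)
    (p : pvector R S) (p' : pvector R S') (X : S -> G) (X' : S' -> G) (g : G -> U) (c : R) :
  tv_within c (push_pvector p X) (push_pvector p' X') ->
  (tv (law p (fun t => g (X t))) (law p' (fun t => g (X' t))) <= c%:E)%E.
Proof.
have one S1 S2 (p1 : pvector R S1) (p2 : pvector R S2) X1 X2 A :
    tv_within c (push_pvector p1 X1) (push_pvector p2 X2) ->
    (law p1 (fun t => g (X1 t)) A <= law p2 (fun t => g (X2 t)) A + c%:E)%E.
  have f01 : test_fun (fun x : G => \1_A (g x) : R) by move=> x; exact: test_indic.
  by move=> /(_ _ f01); rewrite !expect_push// !law_expect -EFinD lee_fin.
move=> pp'; apply: tv_le => A _; first exact: one.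
by apply: one; exact: tv_within_sym.
Qed.

(** * Errors of order $1/n$ and the explicit constant *)

Section rates.
Context (R : realType) (Y : finType) (y0 y1 : Y) (alpha : bool -> Y -> R) (q M : R).
Hypothesis q01 : 0 <= q <= 1.
Hypothesis alpha0 : forall b y, y != dominant y0 y1 b -> 0 <= alpha b y.

(** Bounds $n$ times the error probability of any user. Absolute values keep every summand
    nonnegative, whatever the signs of [M] and of [alpha] at dominant outputs. *)
Definition total_rate : R := \sum_(j : bool * Y) (`|alpha j.1 j.2| + `|M|).

(** The square pays for the $n$ users, the last sum for the changes of rate; the leading $1$ ensures
    positivity. *)
Definition approx_const : R :=
  1 + total_rate ^+ 2 +
  \sum_(j : bool * Y) (`|M| + (`|M| + 1) * `|alpha j.1 j.2|).

Lemma approx_const_gt0 : 0 < approx_const.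
Proof.
by rewrite /approx_const -addrA ltr_pwDl// addr_ge0 ?sqr_ge0// sumr_ge0.
Qed.

Context (w : bool -> pvector R Y) (n l : nat).
Hypotheses (n0 : (0 < n)%N) (ln : (l <= n)%N).
Hypothesis w_alpha : forall b y, y != dominant y0 y1 b ->
  `|n%:R * w b y - alpha b y| <= M / n%:R.
(** The $+1$ leaves room for $l=k+1$, which moves $l/n$ by $1/n$. *)
Hypothesis l_q : `|l%:R / n%:R - q| <= (`|M| + 1) / n%:R.

Let N0 : 0 < n%:R :> R. Proof. by rewrite ltr0n. Qed.

Let Mn : M / n%:R <= `|M| / n%:R.
Proof. by rewrite ler_pM2r ?invr_gt0// ler_norm. Qed.

(** For $y\ne y_b$, $nW_b(y)\le\alpha_b(y)+|M|/n\le|\alpha_b(y)|+|M|$ because $n\ge1$. *)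
Lemma user_error_le b : user_error y0 y1 w b <= (total_rate / n%:R) ^+ 2.
Proof.
rewrite ler_sqr ?nnegrE; first last.
- by rewrite divr_ge0// sumr_ge0// => j _; rewrite addr_ge0.
- by apply: sumr_ge0 => y _; exact: pvector_ge0.
have total b' : \sum_y (`|alpha b' y| + `|M|) <= total_rate.
  rewrite /total_rate -(pair_bigA _ (fun b y => `|alpha b y| + `|M|))/= (bigD1 b')//=.
  by rewrite lerDl sumr_ge0// => c _; rewrite sumr_ge0// => y _; rewrite addr_ge0.
apply: (@le_trans _ _ ((\sum_y (`|alpha b y| + `|M|)) / n%:R)); last first.
  by rewrite ler_pM2r ?invr_gt0.
rewrite mulr_suml big_mkcond/=; apply: ler_sum => y _; case: ifP => [yb|_]; last first.
  by rewrite divr_ge0// addr_ge0.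
rewrite ler_pdivlMr// mulrC.
have Mle : `|M| / n%:R <= `|M| by rewrite ler_pdivrMr// ler_peMr// ler1n.
have := le_trans (le_trans (w_alpha yb) Mn) Mle.
by rewrite ler_norml => /andP[_]; have := ler_norm (alpha b y); lra.
Qed.

Lemma rate_error_le (j : bool * Y) : j.2 != dominant y0 y1 j.1 ->
  rate_error w alpha q n l j <= (`|M| + (`|M| + 1) * `|alpha j.1 j.2|) / n%:R.
Proof.
case: j => b y /= yb; rewrite /rate_error/=.
pose r : R := (users n l b)%:R / n%:R.
have r0 : 0 <= r by rewrite divr_ge0.
have r1 : r <= 1.
  by rewrite ler_pdivrMr// mul1r ler_nat; case: b @r r0 {yb} => //= _; exact: leq_subr.
have r_weight : `|r - input_weight q b| <= (`|M| + 1) / n%:R.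
  rewrite /r; case: b {r r0 r1 yb} => //=.
  rewrite natrB// mulrBl divff ?gt_eqF// distrC.
  by rewrite (_ : 1 - q - (1 - l%:R / n%:R) = l%:R / n%:R - q)//; ring.
(* With $r=n_b/n\le1$, this separates the error in the randomizer from the error in the proportion
   of inputs. *)
have -> : (users n l b)%:R * w b y - input_weight q b * alpha b y =
    r * (n%:R * w b y - alpha b y) + (r - input_weight q b) * alpha b y.
  by rewrite /r; field; rewrite gt_eqF.
clearbody r; apply: le_trans (ler_normD _ _) _.
rewrite !normrM (ger0_norm r0) mulrDl mulrAC.
apply: lerD; last by rewrite ler_wpM2r.
apply: le_trans (le_trans (w_alpha yb) Mn).
by rewrite ler_piMl.
Qed.

Lemma total_error_le :
  \sum_(i < n) user_error y0 y1 w (i < l)%N +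
  \sum_(j | j.2 != dominant y0 y1 j.1) rate_error w alpha q n l j <=
  approx_const / n%:R.
Proof.
rewrite /approx_const mulrDl; apply: lerD.
  apply: (@le_trans _ _ (total_rate ^+ 2 / n%:R)); last first.
    by rewrite ler_pM2r ?invr_gt0// lerDr.
  (* Each of the $n$ users costs $O(1/n^2)$, which leaves a single factor $1/n$. *)
  apply: (@le_trans _ _ (\sum_(i < n) (total_rate / n%:R) ^+ 2)).
    by apply: ler_sum => i _; exact: user_error_le.
  rewrite sumr_const card_ord -mulr_natl le_eqVlt; apply/orP; left; apply/eqP.
  by field; rewrite gt_eqF.
rewrite mulr_suml [leRHS](bigID (fun j => j.2 != dominant y0 y1 j.1))/=.
apply: ler_wpDr.
  by apply: sumr_ge0 => j _; rewrite divr_ge0// addr_ge0// mulr_ge0// addr_ge0.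
by apply: ler_sum => j; exact: rate_error_le.
Qed.

(** [g] will be the identity for $P_n$ and the translation by $e_{y_1}-e_{y_0}$ for $Q_n$. *)
Lemma tv_hist_limit (g : histogram Y -> histogram Y) :
  (tv (law (messages n w l) (fun m => g (\sum_(i < n) displacement y0 y1 (i < l)%N (m i))%R))
      (law (poisson_family alpha q) (fun u => g (limit_hist y0 y1 u)))
   <= (approx_const / n%:R)%:E)%E.
Proof.
rewrite (_ : limit_hist y0 y1 =
    fun u => \sum_(j : bool * Y) displacement y0 y1 j.1 j.2 *+ u j); last first.
  by apply/funext => u; exact: limit_histE.
apply: tv_law_le; apply: tv_within_le total_error_le _; exact: tv_within_histogram.
Qed.

End rates.

Theorem corollary5p10 (R : realType) (Y : finType) (y0 y1 : Y)
    (alpha : bool -> Y -> R) (q : R) (hq : 0 <= q <= 1) (M : R) :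
  exists2 C : R, 0 < C &
    forall (W : nat -> bool -> pvector R Y) (k : nat -> nat),
    sparse_error_critical W y0 y1 alpha ->
    (forall n b y, (0 < n)%N -> y != dominant y0 y1 b ->
      `|n%:R * W n b y - alpha b y| <= M / n%:R) ->
    (forall n, (0 < n)%N -> (k n < n)%N) ->
    (forall n, (0 < n)%N -> `|(k n)%:R / n%:R - q| <= M / n%:R) ->
    forall n, (0 < n)%N ->
    let P := centered_law n (W n) y0 y1 (k n) (k n) in
    let Q := centered_law n (W n) y0 y1 (k n) (k n).+1 in
    let Pinf := limit_law0 y0 y1 alpha q in
    let Qinf := limit_law1 y0 y1 alpha q in
    (le_cam P Q Pinf Qinf <= (C / n%:R)%:E)%E /\
    (forall eps : R, 0 <= eps ->
      (`|privacy_curve Q P eps - privacy_curve Qinf Pinf eps|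
         <= (C * (1 + expR eps) / n%:R)%:E)%E).
Proof.
exists (approx_const alpha M); first exact: approx_const_gt0.
move=> W k [_ alpha0 _ _] W_alpha k_lt k_q n n0 P Q Pinf Qinf.
have N0 : 0 < n%:R :> R by rewrite ltr0n.
have kn := k_lt n n0.
have k_q1 : `|(k n)%:R / n%:R - q| <= (`|M| + 1) / n%:R.
  apply: le_trans (k_q n n0) _; rewrite ler_pM2r ?invr_gt0//.
  by have := ler_norm M; lra.
have k1_q1 : `|(k n).+1%:R / n%:R - q| <= (`|M| + 1) / n%:R.
  rewrite -natr1 !mulrDl mul1r addrAC.
  apply: le_trans (ler_normD _ _) _; rewrite [`|_^-1|]ger0_norm ?invr_ge0//.
  rewrite lerD2r; apply: le_trans (k_q n n0) _.
  by rewrite ler_pM2r ?invr_gt0// ler_norm.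
have PPinf : (tv P Pinf <= (approx_const alpha M / n%:R)%:E)%E.
  have := @tv_hist_limit _ _ _ _ _ _ M hq alpha0 (W n) n (k n) n0 (ltnW kn)
    (fun b y => W_alpha n b y n0) k_q1 id.
  congr (tv _ _ <= _)%E; congr law; apply/funext => m.
  by rewrite (centered_histE _ _ _ _ (ltnW kn)) !subrr !addr0.
have QQinf : (tv Q Qinf <= (approx_const alpha M / n%:R)%:E)%E.
  have := @tv_hist_limit _ _ _ _ _ _ M hq alpha0 (W n) n (k n).+1 n0 kn
    (fun b y => W_alpha n b y n0) k1_q1 (fun h => h + basis_vec y1 - basis_vec y0).
  congr (tv _ _ <= _)%E; congr law; apply/funext => m.
  rewrite (centered_histE _ _ _ _ kn).
  (* Since $k<n$, $n-k=(n-k-1)+1$; after cancellation one copy of each dominant vector remains,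
     giving the shift $e_{y_1}-e_{y_0}$. *)
  rewrite -(subnSK kn) [basis_vec y0 *+ _.+1]mulrS [basis_vec y1 *+ _.+1]mulrS.
  by rewrite addrK opprD [basis_vec y0 *+ _ + _]addrCA subrr addr0 addrAC.
split.
  by apply: le_trans (le_cam_le_tv _ _ _ _) _; rewrite ge_max PPinf.
by move=> eps _; rewrite mulrAC; exact: privacy_curve_tv.
Qed.
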